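(* Let $F$ be a 2-balanced graph with $e(F)\ge 2$ and let $2\le r< v(F)$ be an integer. Then for all $n$ and all $1\le N\le \binom{n}{r}$, there exists an $n$-vertex graph $G$ with $\mathcal{N}(K_r,G)=\Omega(N)$ and \[\mathcal{N}(F,G)=O\left((N n^{-r})^{e(F)\varphi} n^{v(F)}\right),\qquad\text{where}\qquad \varphi:=\frac{v(F)-2}{(r-2)(e(F)-1)+v(F)-2}.\]
   Context: For graphs $F,G$, $\mathcal{N}(F,G)$ is the number of subgraphs of $G$ isomorphic to $F$; $v(F)$ and $e(F)$ denote the numbers of vertices and edges of $F$. A graph $F$ is 2-balanced if for every subgraph $F'\subseteq F$ with $v(F')\ge 3$ we have $\frac{e(F')-1}{v(F')-2}\le \frac{e(F)-1}{v(F)-2}$. The implicit constants in $\Omega,O$ depend only on $F$ and $r$ (not on $n$ or $N$). *)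

(* Defs.v *)
From mathcomp Require Import all_boot all_order all_algebra.
From mathcomp Require Import reals exp.

Set Implicit Arguments.
Unset Strict Implicit.
Unset Printing Implicit Defensive.

Import Order.TTheory GRing.Theory Num.Theory.
Local Open Scope ring_scope.

Record sgraph (V : finType) := SGraph {
  adj :> rel V;
  adj_sym : symmetric adj;
  adj_irr : irreflexive adj }.

Definition edges (V : finType) (G : sgraph V) : {set {set V}} :=
  [set e : {set V} | [exists x : V, exists y : V, G x y && (e == [set x; y])]].

Definition v (V : finType) (G : sgraph V) : nat := #|V|.
Definition e (V : finType) (G : sgraph V) : nat := #|edges G|.

Lemma complete_sym (r : nat) : symmetric (fun x y : 'I_r => x != y).
Proof. by move=> x y; rewrite eq_sym. Qed.

Lemma complete_irr (r : nat) : irreflexive (fun x y : 'I_r => x != y).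
Proof. by move=> x; rewrite eqxx. Qed.

Definition K (r : nat) : sgraph 'I_r := SGraph (@complete_sym r) (@complete_irr r).

(* A subgraph, not necessarily induced or spanning, is a pair (S, E) of a
   vertex set and an edge set. *)
Definition is_subgraph (V : finType) (G : sgraph V)
    (H : {set V} * {set {set V}}) : bool :=
  (H.2 \subset edges G) && [forall f in H.2, f \subset H.1].

(* Intended for H a subgraph of a graph on V: there is a bijection from the
   vertices of F onto H.1 preserving adjacency and non-adjacency. *)
Definition isomorphic_to (U V : finType) (F : sgraph U)
    (H : {set V} * {set {set V}}) : bool :=
  [exists phi : {ffun U -> V},
    [&& injectiveb phi, phi @: [set: U] == H.1 &
        [forall x : U, forall y : U, F x y == ([set phi x; phi y] \in H.2)]]].

Definition num_copies (U V : finType) (F : sgraph U) (G : sgraph V) : nat :=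
  #|[set H : {set V} * {set {set V}} | is_subgraph G H && isomorphic_to F H]|.

(* The subtractions take place in rat, hence are not truncated. *)
Definition two_balanced (V : finType) (F : sgraph V) : Prop :=
  forall H : {set V} * {set {set V}}, is_subgraph F H -> (3 <= #|H.1|)%N ->
    (#|H.2|%:R - 1) / (#|H.1|%:R - 2) <= ((e F)%:R - 1) / ((v F)%:R - 2) :> rat.

Definition varphi (R : realType) (V : finType) (F : sgraph V) (r : nat) : R :=
  ((v F)%:R - 2) / ((r%:R - 2) * ((e F)%:R - 1) + (v F)%:R - 2).

(* Main.v *)
Require Import Defs.
From mathcomp Require Import all_boot all_order all_algebra.
From mathcomp Require Import reals exp.
From mathcomp Require Import zify ring lra.

(** Write [A = e F - 1], [D = v F - 2], [K = 2 A - D] and let [tau] be the number with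
    [tau ^ (A (r - 2) + D) = N / n ^ r].  The graph is a union of [t = tau ^ - K] random
    cliques on about [tau ^ A * n] vertices each: it has about [t (tau ^ A * n) ^ r = N] copies
    of [K_r], and two given vertices are adjacent with probability about [tau ^ D].  A copy of
    [F] distributes its edges among the cliques; if a clique receives [m] edges spanning [q]
    vertices, then 2-balancedness gives [A q >= D m + K], so the expected number of choices
    [t * tau ^ (A q)] for that clique is at most [tau ^ (D m)].  Multiplying over the cliques,
    the expected number of copies of [F] is [O (tau ^ (D (e F)) * n ^ (v F))], as required.
    If [tau ^ A * n < 1], one takes instead about [delta N] random cliques of size [r]; a copy
    of [F] must use two of them, so there are few copies, and deleting one clique per copy
    leaves no copy at all. *)

Import Order.TTheory GRing.Theory Num.Theory.
Local Open Scope ring_scope.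

(** * Elementary inequalities and counting *)

(** Bernoulli's inequality in the form [(1 - q) ^+ t * (1 + t q) <= 1]. It serves to bound from
    below the probability that at least one of [t] independent events of probability [q] occurs. *)
Lemma one_sub_exp_ge {R : realFieldType} (q : R) (t : nat) :
  0 <= q <= 1 -> t%:R * q / (1 + t%:R * q) <= 1 - (1 - q) ^+ t.
Proof.
move=> /andP[q0 q1].
have tq k : 0 <= k%:R * q by rewrite mulr_ge0.
have bern k : (1 - q) ^+ k * (1 + k%:R * q) <= 1.
  elim: k => [|k IHk]; first by rewrite expr0 mul0r; lra.
  apply: le_trans IHk; rewrite exprS mulrAC mulrC; apply: ler_wpM2l.
    by rewrite exprn_ge0 //; lra.
  have := tq k; rewrite -natr1; nra.
have t1 : 0 < 1 + t%:R * q by have := tq t; lra.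
rewrite ler_pdivrMr // mulrBl mul1r; have := bern t; lra.
Qed.

Lemma exists_ge_average {R : realFieldType} {T : finType} (g : T -> R) (a : R) :
  (0 < #|T|)%N -> #|T|%:R * a <= \sum_x g x -> exists x, a <= g x.
Proof.
move=> T0 le_a; apply/existsP; apply: contraLR le_a => /existsPn lt_a.
rewrite -ltNge mulr_natl -sumr_const.
have /card_gt0P[x0 _] := T0.
apply: ltr_sum => [|x _]; last by rewrite ltNge lt_a.
by apply/hasP; exists x0 => //; rewrite mem_index_enum.
Qed.

Lemma exp_le_ffact (r n : nat) : (r <= n)%N -> (n ^ r <= r ^ r * n ^_ r)%N.
Proof.
have expE m : (m ^ r = \prod_(i < r) m)%N by rewrite prod_nat_const card_ord.
move=> rn; rewrite ffact_prod !expE -big_split /=.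
by apply: leq_prod => i _; have := ltn_ord i; nia.
Qed.

Lemma card_le_imset {A B : finType} (g : A -> B) (S : {set A}) (m : nat) :
  (forall b, #|[set a in S | g a == b]| <= m)%N -> (#|S| <= m * #|g @: S|)%N.
Proof.
move=> fib; rewrite -sum1_card (partition_big_imset g) /= mulnC -sum_nat_const.
by apply: leq_sum => b _; rewrite sum1dep_card; apply: leq_trans (fib b); rewrite cardsE.
Qed.

(** In the application [f] records which of [t] cliques contains each edge of a graph; the point is
    that the bound does not depend on [t]. *)
Lemma sum_image_weight {R : realFieldType} {E : finType} (t : nat) : (0 < t)%N ->
  \sum_(f : {ffun E -> 'I_t}) (t%:R ^- #|f @: setT| : R) <= (#|E| ^ #|E|)%:R.
Proof.
move=> t0.
(* Replacing each point by a representative of its fibre turns [f] into a self-map [g] of [E];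
   given [g], the map [f] is determined by its values on the image of [g]. *)
pose rep (f : {ffun E -> 'I_t}) : {ffun E -> E} := [ffun x => odflt x [pick y | f y == f x]].
have repE (f : {ffun E -> 'I_t}) x : f (rep f x) = f x.
  by rewrite ffunE; case: pickP => [y /eqP|].
have rep_inj (f : {ffun E -> 'I_t}) x y : f x = f y -> rep f x = rep f y.
  move=> fxy; rewrite !ffunE fxy; case: pickP => // /(_ y).
  by rewrite eqxx.
have im_rep (f : {ffun E -> 'I_t}) : #|f @: setT| = #|rep f @: setT|.
  have -> : f @: setT = f @: (rep f @: setT).
    by rewrite -imset_comp; apply: eq_imset => x /=; rewrite repE.
  apply: card_in_imset => _ _ /imsetP[x _ ->] /imsetP[y _ ->].
  by rewrite !repE; apply: rep_inj.
rewrite (partition_big rep predT) //= -card_ffun -sum1_card natr_sum.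
apply: ler_sum => g _.
under eq_bigr => f /eqP fg do rewrite im_rep fg.
rewrite sumr_const -[leLHS]mulr_natr mulrC ler_pdivrMr ?exprn_gt0 ?ltr0n //.
rewrite mul1r -natrX ler_nat.
have -> : (t ^ #|g @: setT|)%N = #|{ffun {z | z \in g @: setT} -> 'I_t}|.
  by rewrite card_ffun card_sig card_ord.
pose res (f : {ffun E -> 'I_t}) := [ffun z : {z | z \in g @: setT} => f (val z)].
rewrite -(card_in_imset (f := res)) ?max_card //.
move=> f1 f2 h1 h2 /ffunP e12; apply/ffunP => x.
have g1 : rep f1 = g by apply/eqP.
have g2 : rep f2 = g by apply/eqP.
have gx : g x \in g @: setT by apply: imset_f.
have := e12 (Sub (g x) gx); rewrite !ffunE /=.
by rewrite -{1}g1 -g2 !repE.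
Qed.

(** * Random blocks *)

(** A block is an array of vertices with repetitions allowed. A uniform random block thus has
    independent entries, and expectations become sums over a function type. *)
Definition block_set {I J V : finType} (h : {ffun I -> {ffun J -> V}}) : {set V} :=
  [set x | [exists i, exists j, h i j == x]].

(* Choose a position in [h] for each element of [S]: the values at these positions are forced,
   so they can be exchanged for an arbitrary map [S -> V] without losing information. *)
Lemma card_block_cover {I J V : finType} (S : {set V}) :
  (#|[set h : {ffun I -> {ffun J -> V}} | S \subset block_set h]| * #|V| ^ #|S| <=
   (#|I| * #|J|) ^ #|S| * #|{ffun I -> {ffun J -> V}}|)%N.
Proof.
pose B := {ffun I -> {ffun J -> V}}; pose T := {x | x \in S}.
pose A := [set h : B | S \subset block_set h].
rewrite -/B -/A; have [->|/set0Pn[h0 Ah0]] := eqVneq A set0; first by rewrite cards0.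
have [S0|/set0Pn[x0 Sx0]] := eqVneq S set0.
  by rewrite S0 !cards0 !expn0 muln1 mul1n max_card.
have [p0] : exists p0 : I * J, True.
  move: Ah0; rewrite inE => /subsetP/(_ _ Sx0); rewrite inE => /existsP[i /existsP[j _]].
  by exists (i, j).
move=> _.
pose pos (h : B) : {ffun T -> I * J} :=
  [ffun x => odflt p0 [pick p | h p.1 p.2 == val x]].
have posE h x : h \in A -> h (pos h x).1 (pos h x).2 = val x.
  rewrite inE => /subsetP/(_ _ (valP x)); rewrite inE => /existsP[i /existsP[j /eqP hx]].
  by rewrite ffunE; case: pickP => [p /eqP//|/(_ (i, j))]; rewrite /= hx eqxx.
pose upd (hw : B * {ffun T -> V}) : {ffun T -> I * J} * B :=
  (pos hw.1, [ffun i => [ffun j => if [pick x | pos hw.1 x == (i, j)] is Some x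
                                   then hw.2 x else hw.1 i j]]).
have -> : (#|V| ^ #|S|)%N = #|{ffun T -> V}| by rewrite card_ffun card_sig.
have -> : ((#|I| * #|J|) ^ #|S|)%N = #|{ffun T -> I * J}|.
  by rewrite card_ffun card_prod card_sig.
rewrite -[X in (_ * X)%N]cardsT -cardsX -card_prod.
rewrite -(card_in_imset (f := upd)) ?max_card //.
move=> [h w] [h' w']; rewrite !inE /= !andbT => Ah Ah' [] epos /ffunP eupd.
have {}Ah : h \in A by rewrite inE.
have {}Ah' : h' \in A by rewrite inE.
have posI x y : pos h x = pos h y -> x = y.
  by move=> exy; apply: val_inj; rewrite -(posE h x) // exy posE.
congr pair.
  apply/ffunP => i; apply/ffunP => j; move/ffunP/(_ j): (eupd i); rewrite !ffunE -epos.
  case: pickP => [x /eqP ex _|//].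
  have := posE h x Ah; have := posE h' x Ah'; rewrite -epos ex /= => -> ->.
  by [].
apply/ffunP => x; case ex: (pos h x) => [a b].
move/ffunP/(_ b): (eupd a); rewrite !ffunE -epos.
case: pickP => [y /eqP|/(_ x)]; last by rewrite ex eqxx.
by rewrite -ex => /posI ->.
Qed.

(** * Unions of cliques, and 2-balanced graphs *)

Lemma union_cliques_sym {T V : finType} (C : T -> {set V}) (J : {set T}) :
  symmetric (fun x y => (x != y) && [exists j in J, (x \in C j) && (y \in C j)]).
Proof.
move=> x y; rewrite eq_sym; congr (_ && _).
by apply: eq_existsb => j; congr (_ && _); rewrite andbC.
Qed.

Lemma union_cliques_irr {T V : finType} (C : T -> {set V}) (J : {set T}) :
  irreflexive (fun x y => (x != y) && [exists j in J, (x \in C j) && (y \in C j)]).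
Proof. by move=> x; rewrite eqxx. Qed.

Definition union_cliques {T V : finType} (C : T -> {set V}) (J : {set T}) : sgraph V :=
  SGraph (union_cliques_sym C J) (union_cliques_irr C J).

Lemma edgesP {V : finType} (G : sgraph V) (x : {set V}) :
  reflect (exists a b, G a b /\ x = [set a; b]) (x \in edges G).
Proof.
rewrite inE; apply: (iffP existsP) => [[a /existsP[b /andP[Gab /eqP ->]]]|[a [b [Gab ->]]]].
  by exists a, b.
by exists a; apply/existsP; exists b; rewrite Gab eqxx.
Qed.

Lemma card_edge {V : finType} (G : sgraph V) (x : {set V}) : x \in edges G -> #|x| = 2%N.
Proof.
case/edgesP => a [b [Gab ->]]; rewrite cards2.
by case: eqVneq Gab => // ->; rewrite adj_irr.
Qed.

(** This is 2-balancedness for the subgraph [(cover S, S)], with denominators cleared and each term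
    on the side where it is positive. If [cover S] has at most two vertices, then [S] is a single
    edge and the inequality is checked directly. *)
Lemma two_balanced_edges {U : finType} (F : sgraph U) (S : {set {set U}}) :
  two_balanced F -> (3 <= v F)%N -> (1 <= e F)%N -> S \subset edges F -> S != set0 ->
  ((v F - 2) * #|S| + 2 * (e F - 1) <= (e F - 1) * #|cover S| + (v F - 2))%N.
Proof.
move=> hF v3 e1 SF S0.
have supC z : z \in S -> z \subset cover S by move=> zS; apply: (bigcup_sup z).
have [cov3|cov2] := leqP 3 #|cover S|; last first.
  have S1 : (#|S| <= 1)%N.
    apply/card_le1_eqP; suff eqS z : z \in S -> z = cover S by move=> x y /eqS -> /eqS ->.
    by move=> zS; apply/eqP; rewrite eqEcard supC //= (card_edge F z) //; apply: (subsetP SF).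
  have /set0Pn[x xS] := S0.
  have : (2 <= #|cover S|)%N.
    by rewrite -(card_edge F x (subsetP SF _ xS)) subset_leq_card // supC.
  have -> : #|S| = 1%N by apply/eqP; rewrite eqn_leq S1 card_gt0.
  by nia.
have sub : is_subgraph F (cover S, S).
  by rewrite /is_subgraph /= SF; apply/forall_inP => x xS; rewrite supC.
have := hF _ sub cov3; rewrite /= ler_pdivrMr; last by rewrite subr_gt0 ltr_nat.
rewrite mulrAC ler_pdivlMr; last by rewrite subr_gt0 ltr_nat.
rewrite -(ler_nat rat) !natrD !natrM !natrB //; last exact: ltnW v3.
lra.
Qed.

(** Taking [S = edges F] in [two_balanced_edges] gives [(e F - 1) * v F <= (e F - 1) * #|cover
    (edges F)|]. *)
Lemma cover_edges {U : finType} (F : sgraph U) :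
  two_balanced F -> (3 <= v F)%N -> (2 <= e F)%N -> cover (edges F) = setT.
Proof.
move=> hF v3 e2; apply/eqP; rewrite eqEcard subsetT cardsT /=.
have E0 : edges F != set0 by rewrite -card_gt0; apply: leq_trans e2.
have := two_balanced_edges F _ hF v3 (ltnW e2) (subxx _) E0.
have e1 : (0 < e F - 1)%N by lia.
rewrite -(leq_pmul2l e1) -/(v F) -/(e F); move: e1 v3 e2.
move: (e F) (v F) #|cover _| => a b c; nia.
Qed.

(** Two edges cover at most four vertices. The bound ensures that [2 * (e F - 1) - (v F - 2)], the
    [K] of the overview, is not truncated. *)
Lemma two_balanced_v_le {U : finType} (F : sgraph U) :
  two_balanced F -> (3 <= v F)%N -> (2 <= e F)%N -> (v F - 2 <= 2 * (e F - 1))%N.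
Proof.
move=> hF v3 e2.
have [x xF] : exists x, x \in edges F by apply/set0Pn; rewrite -card_gt0; apply: leq_trans e2.
have [y] : exists y, y \in edges F :\ x.
  by apply/set0Pn; rewrite -card_gt0; move: e2; rewrite /e (cardsD1 x) xF.
rewrite in_setD1 => /andP[yx yF].
have sub : [set x; y] \subset edges F.
  by apply/subsetP => z; rewrite !in_set2 => /orP[] /eqP ->.
have n0 : [set x; y] != set0 by apply/set0Pn; exists x; rewrite !inE eqxx.
have := two_balanced_edges F _ hF v3 (ltnW e2) sub n0.
have : (#|cover [set x; y]| <= 4)%N.
  rewrite /cover bigcup_setU !big_set1; apply: leq_trans (leq_card_setU _ _) _.
  by rewrite (card_edge F x) ?(card_edge F y) ?(subsetP sub) // !inE eqxx ?orbT.
rewrite cards2 eq_sym yx /=; move: e2; nia.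
Qed.

(** * Copies of [F] in a union of random cliques *)

Definition edge_sub {U : finType} (F : sgraph U) : finType := {x : {set U} | x \in edges F}.

(** A labelled copy of [F] with a choice, for each edge, of one clique containing it. Such pairs
    overcount the copies, but for a fixed pair the condition splits into one condition per
    clique. *)
Definition covered {T U V : finType} {F : sgraph U} (C : T -> {set V}) (J : {set T})
    (p : {ffun U -> V} * {ffun edge_sub F -> T}) : bool :=
  injectiveb p.1 && [forall k, (p.2 k \in J) && (p.1 @: val k \subset C (p.2 k))].

Lemma num_copies_union_cliques {T U V : finType} (F : sgraph U) (C : T -> {set V})
    (J : {set T}) :
  (num_copies F (union_cliques C J) <= #|[set p | covered (F := F) C J p]|)%N.
Proof.
pose H (p : {ffun U -> V} * {ffun edge_sub F -> T}) :=
  (p.1 @: setT, [set p.1 @: x | x : {set U} in edges F]).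
apply: leq_trans (leq_imset_card H _); apply: subset_leq_card.
apply/subsetP => -[H1 H2]; rewrite inE /= => /andP[/andP[/= H2G /forall_inP H21]].
case/existsP => phi /and3P[/injectiveP phiI /eqP /= phiT /forallP phiE].
have phi_edge u w : F u w = ([set phi u; phi w] \in H2).
  by have /forallP/(_ w)/eqP := phiE u.
have H2E : H2 = [set phi @: x | x : {set U} in edges F].
  apply/setP => y; apply/idP/imsetP => [yH2|[x /edgesP[a [b [Fab ->]]] ->]]; last first.
    by rewrite imsetU1 imset_set1 -phi_edge.
  have /edgesP[a [b [_ yab]]] := subsetP H2G _ yH2.
  have := H21 _ yH2; rewrite -phiT yab subUset !sub1set.
  move=> /andP[/imsetP[u _ au] /imsetP[w _ bw]]; exists [set u; w].
    by apply/edgesP; exists u, w; split=> //; rewrite phi_edge -au -bw -yab.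
  by rewrite imsetU1 imset_set1 au bw.
have /fin_all_exists[f fP] : forall k : edge_sub F,
    exists j, (j \in J) && (phi @: val k \subset C j).
  move=> [x xF] /=.
  have /(subsetP H2G)/edgesP[a [b [/= /andP[_ /exists_inP[j jJ /andP[aj bj]]] xab]]] :
    phi @: x \in H2 by rewrite H2E imset_f.
  by exists j; rewrite jJ xab subUset !sub1set aj bj.
apply/imsetP; exists (phi, [ffun k => f k]); last by rewrite /H /= phiT H2E.
rewrite inE /covered /=; apply/andP; split; first exact/injectiveP.
by apply/forallP => k; rewrite ffunE.
Qed.

Definition fiber_edges {T U : finType} {F : sgraph U} (f : {ffun edge_sub F -> T}) (j : T) :
  {set {set U}} := [set val k | k in f @^-1: [set j]].

(** The sum over [w] is an expectation over independent uniform blocks. For fixed [phi] and [f],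
    block [j] must contain the images of the endpoints of all edges sent to [j]; [card_block_cover]
    bounds the probability of this, and independence gives the product. *)
Lemma sum_covered {R : realFieldType} {T I J U V : finType} (F : sgraph U)
    (P : pred {ffun edge_sub F -> T}) : (0 < #|V|)%N ->
  \sum_(w : {ffun T -> {ffun I -> {ffun J -> V}}})
     (#|[set p | covered (F := F) (fun j => block_set (w j)) setT p & P p.2]|%:R : R) <=
  #|{ffun T -> {ffun I -> {ffun J -> V}}}|%:R * (#|V| ^ v F)%:R *
  \sum_(f | P f) \prod_j ((#|I| * #|J|)%:R / #|V|%:R) ^+ #|cover (fiber_edges f j)|.
Proof.
move=> V0; pose B := {ffun I -> {ffun J -> V}}.
under eq_bigr => w _ do rewrite -sum1dep_card natr_sum big_mkcond /=.
rewrite exchange_big /=.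
have V0' : 0 < (#|V|%:R : R) by rewrite ltr0n.
have bound (phi : {ffun U -> V}) (f : {ffun edge_sub F -> T}) :
  \sum_(w : {ffun T -> B})
     (if covered (fun j => block_set (w j)) setT (phi, f) && P f then 1%:R else 0 : R) <=
  if P f then #|{ffun T -> B}|%:R *
    \prod_j ((#|I| * #|J|)%:R / #|V|%:R) ^+ #|cover (fiber_edges f j)| else 0.
  case Pf: (P f); last by rewrite big1 // => w _; rewrite andbF.
  rewrite -big_mkcond /= -natr_sum sum1dep_card.
  have [phiI|nphiI] := boolP (injectiveb phi); last first.
    rewrite eq_card0 ?mulr_ge0 ?prodr_ge0 // => [j _|w].
      by rewrite exprn_ge0 // divr_ge0.
    by rewrite !inE /covered /= (negbTE nphiI).
  pose A j := [set h : B | phi @: cover (fiber_edges f j) \subset block_set h].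
  apply: le_trans (_ : (#|family (fun j => mem (A j))|%:R : R) <= _).
    rewrite ler_nat; apply: subset_leq_card; apply/subsetP => w.
    rewrite inE andbT => /andP[_ /forallP cov]; apply/familyP => j; rewrite inE.
    apply/subsetP => _ /imsetP[u /bigcupP[_ /imsetP[k kf ->] uk] ->].
    have fk : f k = j by apply/eqP; move: kf; rewrite !inE.
    by have /andP[_ /subsetP] := cov k; rewrite /= fk; apply; apply: imset_f.
  rewrite card_family foldrE big_map big_enum /= natr_prod.
  have -> : #|{ffun T -> B}|%:R = \prod_(j : T) #|B|%:R :> R.
    by rewrite card_ffun natrX prodr_const.
  rewrite -big_split /=; apply: ler_prod => j _; rewrite ler0n /=.
  rewrite expr_div_n mulrA ler_pdivlMr ?exprn_gt0 // -!natrX -!natrM ler_nat.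
  have /= := @card_block_cover I J V (phi @: cover (fiber_edges f j)).
  rewrite card_imset; last exact/injectiveP.
  rewrite [X in (_ <= X)%N]mulnC; apply: leq_trans; rewrite leq_mul2r; apply/orP; right.
  by apply: subset_leq_card; apply/subsetP => h; rewrite inE.
pose b f : R := if P f then #|{ffun T -> B}|%:R *
    \prod_j ((#|I| * #|J|)%:R / #|V|%:R) ^+ #|cover (fiber_edges f j)| else 0.
apply: le_trans (_ : \sum_(p : {ffun U -> V} * {ffun edge_sub F -> T}) b p.2 <= _).
  apply: ler_sum => -[phi f] _; exact: bound.
rewrite -(pair_bigA _ (fun _ f => b f)) /= /b sumr_const -big_mkcond /= -mulr_sumr.
have <- : #|{ffun U -> V}| = (#|V| ^ v F)%N by rewrite card_ffun.
by rewrite -[leLHS]mulr_natr mulrAC.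
Qed.

(** * Copies of the complete graph *)

(* Vertex number [i] of a copy of the complete graph is only looked for in row [i] of a block:
   the rows are independent, which makes the probability in [sum_transversals] exact. *)
Definition transversals {T I J V : finType} (w : {ffun T -> {ffun I -> {ffun J -> V}}})
    (S : {set T}) : {set {ffun I -> V}} :=
  [set psi : {ffun I -> V} | injectiveb psi & [exists j in S, [forall i, exists b, w j i b == psi i]]].

Lemma card_transversals_le {T I J V : finType} (w : {ffun T -> {ffun I -> {ffun J -> V}}})
    (S : {set T}) : (#|transversals w S| <= #|S| * #|J| ^ #|I|)%N.
Proof.
pose g (p : T * {ffun I -> J}) := [ffun i => w p.1 i (p.2 i)].
rewrite -card_ffun -[X in (_ * X)%N]cardsT -cardsX.
apply: leq_trans (leq_imset_card g _); apply: subset_leq_card; apply/subsetP => psi.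
rewrite inE => /andP[_ /exists_inP[j jS /forallP psij]].
have /fin_all_exists[b bP] : forall i, exists b, w j i b = psi i.
  by move=> i; have /existsP[b /eqP] := psij i; exists b.
apply/imsetP; exists (j, [ffun i => b i]); first by rewrite !inE jS.
by apply/ffunP => i; rewrite !ffunE /= bP.
Qed.

Lemma card_transversals_split {T I J V : finType}
    (w : {ffun T -> {ffun I -> {ffun J -> V}}}) (S : {set T}) :
  (#|transversals w setT| <= #|transversals w S| + #|~: S| * #|J| ^ #|I|)%N.
Proof.
apply: leq_trans (leq_add (leqnn _) (card_transversals_le w (~: S))).
apply: leq_trans (leq_card_setU _ _); apply: subset_leq_card; apply/subsetP => psi.
rewrite !inE => /andP[-> /exists_inP[j _ psij]] /=; apply/orP.
have [jS|jS] := boolP (j \in S); [left|right]; apply/exists_inP; exists j => //.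
by rewrite inE.
Qed.

(** A transversal labels the vertices of a complete subgraph, and [r] vertices have at most [r ^ r]
    labellings. *)
Lemma card_transversals_le_copies {T J V : finType} (r : nat)
    (w : {ffun T -> {ffun 'I_r -> {ffun J -> V}}}) (S : {set T}) :
  (#|transversals w S| <=
   r ^ r * num_copies (K r) (union_cliques (fun j => block_set (w j)) S))%N.
Proof.
pose H (psi : {ffun 'I_r -> V}) : {set V} * {set {set V}} :=
  (psi @: setT, [set x : {set V} | (x \subset psi @: setT) && (#|x| == 2%N)]).
apply: leq_trans (card_le_imset H _ (r ^ r) _) _.
  move=> [A E].
  have [->|/set0Pn[psi0]] := eqVneq [set psi in transversals w S | H psi == (A, E)] set0.
    by rewrite cards0.
  rewrite !inE => /andP[/andP[/injectiveP psi0I _] /eqP [A0 _]].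
  have <- : #|(ffun_on (mem A) : pred {ffun 'I_r -> V})| = (r ^ r)%N.
    by rewrite card_ffun_on -A0 card_imset // cardsT card_ord.
  apply: subset_leq_card.
  apply/subsetP => psi; rewrite !inE => /andP[_ /eqP [A1 _]].
  by apply/ffun_onP => i; rewrite -A1 imset_f.
rewrite leq_mul2l; apply/orP; right; apply: subset_leq_card.
apply/subsetP => _ /imsetP[psi + ->].
rewrite [psi \in _]inE => /andP[/injectiveP psiI /exists_inP[j jS /forallP psij]].
have psi_in i : psi i \in block_set (w j).
  by rewrite inE; apply/existsP; exists i; have /existsP[b psib] := psij i; apply/existsP; exists b.
rewrite inE; apply/andP; split.
  apply/andP; split; last by apply/forall_inP => x; rewrite inE => /andP[].
  apply/subsetP => x; rewrite inE => /andP[xpsi /cards2P[a [b [ab xab]]]].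
  move: xpsi; rewrite xab subUset !sub1set => /andP[/imsetP[i _ ai] /imsetP[k _ bk]].
  apply/edgesP; exists a, b; split=> //=; rewrite ab /=.
  by apply/exists_inP; exists j => //; rewrite ai bk !psi_in.
apply/existsP; exists psi; apply/and3P; split => //; first exact/injectiveP.
apply/forallP => a; apply/forallP => b; rewrite inE /= cards2.
rewrite subUset !sub1set !imset_f //= (inj_eq psiI).
by case: (a == b).
Qed.

(** All [#|V| ^_ #|I|] injective [psi] have the same probability. A row misses a given vertex with
    probability [(1 - 1 / #|V|) ^ #|J|]; the rows of a block are independent, and so are the
    blocks. *)
Lemma sum_transversals {R : realFieldType} {T I J V : finType} : (0 < #|V|)%N ->
  \sum_(w : {ffun T -> {ffun I -> {ffun J -> V}}}) (#|transversals w setT|%:R : R) =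
  #|{ffun T -> {ffun I -> {ffun J -> V}}}|%:R * (#|V| ^_ #|I|)%:R *
  (1 - (1 - (1 - (1 - #|V|%:R^-1) ^+ #|J|) ^+ #|I|) ^+ #|T|).
Proof.
move=> V0; pose B := {ffun I -> {ffun J -> V}}.
have V1 : (#|V|%:R : R) != 0 by rewrite pnatr_eq0 -lt0n.
under eq_bigr => w _ do rewrite -sum1dep_card natr_sum big_mkcond /=.
rewrite exchange_big /=.
pose hit (x : V) := [set h : {ffun J -> V} | [exists b, h b == x]].
have card_hit x : (#|hit x|%:R : R) = #|{ffun J -> V}|%:R * (1 - (1 - #|V|%:R^-1) ^+ #|J|).
  have hitC : (#|~: hit x|%:R : R) = #|{ffun J -> V}|%:R * (1 - #|V|%:R^-1) ^+ #|J|.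
    have -> : #|~: hit x| = #|(ffun_on (mem (~: [set x])) : pred {ffun J -> V})|.
      apply: eq_card => h; rewrite !inE negb_exists; apply/forallP/ffun_onP => hx b.
        by rewrite !inE hx.
      by have := hx b; rewrite !inE.
    rewrite card_ffun_on card_ffun cardsC1 !natrX -exprMn mulrBr mulr1 mulfV //.
    by rewrite -subn1 natrB.
  have := cardsC (hit x); move/(congr1 (fun k : nat => k%:R : R)); rewrite natrD hitC; lra.
pose tr (psi : {ffun I -> V}) := [set h : B | [forall i, h i \in hit (psi i)]].
have card_tr psi : (#|tr psi|%:R : R) =
    #|B|%:R * (1 - (1 - #|V|%:R^-1) ^+ #|J|) ^+ #|I|.
  have -> : #|tr psi| = #|family (fun i => mem (hit (psi i)))|.
    by apply: eq_card => h; rewrite inE.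
  rewrite card_family foldrE big_map big_enum /= natr_prod.
  under eq_bigr => i _ do rewrite card_hit.
  by rewrite big_split /= !prodr_const !cardT -!cardT -natrX -card_ffun.
have bound (psi : {ffun I -> V}) :
  \sum_(w : {ffun T -> B}) (if injectiveb psi &&
     [exists j in setT, [forall i, exists b, w j i b == psi i]] then 1%:R else 0 : R) =
  if injectiveb psi then #|{ffun T -> B}|%:R *
  (1 - (1 - (1 - (1 - #|V|%:R^-1) ^+ #|J|) ^+ #|I|) ^+ #|T|) else 0.
  case: (injectiveb psi) => /=; last by rewrite big1.
  rewrite -big_mkcond /= -natr_sum sum1dep_card.
  set X := [set _ | _].
  have XC : (#|~: X|%:R : R) =
      #|{ffun T -> B}|%:R * (1 - (1 - (1 - #|V|%:R^-1) ^+ #|J|) ^+ #|I|) ^+ #|T|.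
    have -> : #|~: X| = #|(ffun_on (mem (~: tr psi)) : pred {ffun T -> B})|.
      apply: eq_card => w; rewrite !inE negb_exists_in; apply/forallP/ffun_onP => wP j.
        have := wP j; rewrite !inE /=; apply: contra => /forallP h; apply/forallP => i.
        by have := h i; rewrite inE.
      have := wP j; rewrite !inE /=; apply: contra => /forallP h; apply/forallP => i.
      by have := h i; rewrite inE.
    rewrite card_ffun_on card_ffun !natrX -exprMn mulrBr mulr1 -(card_tr psi); congr (_ ^+ _).
    by have := cardsC (tr psi); move/(congr1 (fun k : nat => k%:R : R)); rewrite natrD; lra.
  by have := cardsC X; move/(congr1 (fun k : nat => k%:R : R)); rewrite natrD XC; lra.
rewrite (eq_bigr _ (fun psi _ => bound psi)) -big_mkcond /= sumr_const.
rewrite -[LHS]mulr_natr mulrAC -card_inj_ffuns cardsE.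
by [].
Qed.

(** The constant collects three losses: [#|I| ^- #|I|] from the falling factorial, a factor 3 per
    row from [one_sub_exp_ge] with [#|J| / #|V| <= 2], and a factor 2 from the same lemma applied to
    the blocks, using [y <= 1]. *)
Lemma sum_transversals_ge {R : realFieldType} {T I J V : finType} (y : R) :
  (0 < #|I| <= #|V|)%N -> (#|J| <= 2 * #|V|)%N ->
  0 <= y <= 1 -> y <= #|T|%:R * (#|J|%:R / #|V|%:R) ^+ #|I| ->
  #|{ffun T -> {ffun I -> {ffun J -> V}}}|%:R *
    (y * #|V|%:R ^+ #|I| * ((3 * #|I|%:R) ^- #|I| / 2)) <=
  \sum_(w : {ffun T -> {ffun I -> {ffun J -> V}}}) (#|transversals w setT|%:R : R).
Proof.
move=> /andP[I0 IV] JV /andP[y0 y1] yT; have V0 := leq_trans I0 IV.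
have V1 : 0 < (#|V|%:R : R) by rewrite ltr0n.
have I1 : 0 < (#|I|%:R : R) by rewrite ltr0n.
rewrite sum_transversals // -[leRHS]mulrA ler_wpM2l //.
have ff : (#|V|%:R / #|I|%:R) ^+ #|I| <= (#|V| ^_ #|I|)%:R :> R.
  by rewrite expr_div_n ler_pdivrMr ?exprn_gt0 // mulrC -!natrX -natrM ler_nat exp_le_ffact.
set z := #|V|%:R^-1; have z01 : 0 <= z <= 1.
  by rewrite invr_ge0 ltW //= invf_le1 // ler1n.
set p := 1 - (1 - z) ^+ #|J|.
have sz : 0 <= #|J|%:R * z <= 2.
  by rewrite mulr_ge0 ?ler_pdivrMr // -?natrM ?ler_nat //; case/andP: z01.
have pge : #|J|%:R * z / 3 <= p.
  apply: le_trans (one_sub_exp_ge _ _ z01).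
  rewrite ler_wpM2l //; first by case/andP: sz.
  by rewrite lef_pV2 ?posrE; lra.
have p01 : 0 <= p <= 1.
  apply/andP; split; first by apply: le_trans pge; lra.
  by rewrite /p gerBl exprn_ge0 //; lra.
set q := p ^+ #|I|; have q01 : 0 <= q <= 1.
  by case/andP: p01 => p0 p1; rewrite exprn_ge0 //= exprn_ile1.
have tq : y / 3 ^+ #|I| <= #|T|%:R * q.
  apply: le_trans (_ : #|T|%:R * (#|J|%:R * z / 3) ^+ #|I| <= _).
    by rewrite [X in _ <= _ * X]expr_div_n mulrA ler_wpM2r // invr_ge0 exprn_ge0.
  by rewrite ler_wpM2l // lerXn2r ?nnegrE //; lra.
set y3 := y / 3 ^+ #|I| in tq.
have y30 : 0 <= y3 <= 1.
  rewrite divr_ge0 ?exprn_ge0 //= ler_pdivrMr ?exprn_gt0 // mul1r (le_trans y1) //.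
  by rewrite exprn_ege1 //; lra.
have prob : y3 / 2 <= 1 - (1 - q) ^+ #|T|.
  apply: le_trans (one_sub_exp_ge _ _ q01).
  have tq0 : 0 < 1 + #|T|%:R * q by lra.
  by rewrite ler_pdivlMr //; nra.
apply: le_trans (_ : (#|V|%:R / #|I|%:R) ^+ #|I| * (y3 / 2) <= _); last first.
  apply: ler_pM => //; first by rewrite exprn_ge0 // divr_ge0.
  by case/andP: y30 => y30 _; rewrite divr_ge0.
rewrite le_eqVlt; apply/orP; left; apply/eqP.
rewrite /y3 expr_div_n exprMn; field.
by rewrite !expf_neq0 // ?lt0r_neq0.
Qed.

(** * Distributions of the edges of [F] among the cliques *)

Lemma card_edge_sub {U : finType} (F : sgraph U) : #|edge_sub F| = e F.
Proof. by rewrite card_sig. Qed.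

Lemma card_fiber_edges {T U : finType} {F : sgraph U} (f : {ffun edge_sub F -> T}) (j : T) :
  #|fiber_edges f j| = #|f @^-1: [set j]|.
Proof. by rewrite card_imset //; apply: val_inj. Qed.

Lemma fiber_edges_sub {T U : finType} {F : sgraph U} (f : {ffun edge_sub F -> T}) (j : T) :
  fiber_edges f j \subset edges F.
Proof. by apply/subsetP => _ /imsetP[k _ ->]; apply: valP. Qed.

Lemma fiber_edges_eq0 {T U : finType} {F : sgraph U} (f : {ffun edge_sub F -> T}) (j : T) :
  (fiber_edges f j == set0) = (j \notin f @: setT).
Proof.
rewrite -cards_eq0 card_fiber_edges cards_eq0; apply/idP/idP => [/eqP f0|jf].
  by apply/imsetP => -[k _ jk]; move/setP/(_ k): f0; rewrite !inE -jk eqxx.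
apply/eqP/setP => k; rewrite !inE; apply: contraNF jf => /eqP <-.
exact: imset_f.
Qed.

Lemma sum_card_fiber_edges {T U : finType} {F : sgraph U} (f : {ffun edge_sub F -> T}) :
  (\sum_j #|fiber_edges f j| = e F)%N.
Proof.
rewrite -card_edge_sub -sum1_card (partition_big f predT) //=.
apply: eq_bigr => j _; rewrite card_fiber_edges -sum1_card.
by apply: eq_bigl => k; rewrite !inE.
Qed.

Lemma card_cover_edges {U : finType} (F : sgraph U) (S : {set {set U}}) :
  S \subset edges F -> (#|cover S| <= 2 * #|S|)%N.
Proof.
move=> SF; apply: leq_trans (leq_card_cover S) _.
rewrite mulnC -sum_nat_const; apply: leq_sum => x xS.
by rewrite (card_edge F) ?(subsetP SF).
Qed.

(** If [j] receives [m > 0] edges with [q] endpoints, its factor is at most [B ^ q * tau ^ (A q)],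
    where [q <= 2 m] and, by [two_balanced_edges], [A q >= D m + K]. The numbers [m] add up to
    [e F], while [tau ^ K] is gained once for each [j] in the image of [f]. *)
Lemma prod_fiber_le {R : realFieldType} {T U : finType} (F : sgraph U) (tau B rho : R)
    (f : {ffun edge_sub F -> T}) :
  two_balanced F -> (3 <= v F)%N -> (2 <= e F)%N ->
  0 < tau <= 1 -> 1 <= B -> 0 <= rho <= B * tau ^+ (e F - 1) ->
  \prod_j rho ^+ #|cover (fiber_edges f j)| <=
  B ^+ (2 * e F) * tau ^+ ((v F - 2) * e F) *
    (tau ^+ (2 * (e F - 1) - (v F - 2))) ^+ #|f @: setT|.
Proof.
move=> hF v3 e2 /andP[tau0 tau1] B1 /andP[rho0 rhoB].
set A := (e F - 1)%N; set D := (v F - 2)%N; set K := (2 * A - D)%N.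
have KE : (K + D = 2 * A)%N by rewrite subnK // two_balanced_v_le.
have B0 : 0 <= B by apply: le_trans B1.
have -> : B ^+ (2 * e F) * tau ^+ (D * e F) * (tau ^+ K) ^+ #|f @: setT| =
    \prod_(j : T) (B ^+ (2 * #|fiber_edges f j|) * tau ^+ (D * #|fiber_edges f j|) *
               (if j \in f @: setT then tau ^+ K else 1)).
  rewrite !big_split /= -big_mkcond /= prodr_const; congr (_ * _ * _).
    under eq_bigr do rewrite exprM.
    by rewrite prodrXr sum_card_fiber_edges -exprM.
  under eq_bigr do rewrite exprM.
  by rewrite prodrXr sum_card_fiber_edges -exprM.
apply: ler_prod => j _; rewrite exprn_ge0 //=.
have [f0|f0] := eqVneq (fiber_edges f j) set0.
  rewrite f0 /cover big_set0 !cards0 !muln0 !expr0 mulr1 ifN ?mulr1 //.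
  by rewrite -fiber_edges_eq0 f0.
have -> : j \in f @: setT by move: f0; rewrite fiber_edges_eq0 negbK.
have cov := two_balanced_edges F _ hF v3 (ltnW e2) (fiber_edges_sub f j) f0.
have cov2 := card_cover_edges F _ (fiber_edges_sub f j).
apply: le_trans (_ : (B * tau ^+ A) ^+ #|cover (fiber_edges f j)| <= _).
  by rewrite lerXn2r // nnegrE // (le_trans rho0).
rewrite exprMn -exprM -mulrA -exprD; apply: ler_pM; rewrite ?exprn_ge0 ?(ltW tau0) //.
  by rewrite ler_weXn2l.
apply: ler_wiXn2l => //; first exact: ltW.
by rewrite -(leq_add2r D) -addnA KE.
Qed.

(** The hypothesis on [z] replaces the last factor in [prod_fiber_le] by [z * t ^- #|f @: setT|],
    which [sum_image_weight] sums. Restricting to [P] allows a smaller [z] when [f] must use several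
    cliques. *)
Lemma sum_prod_fiber_le {R : realFieldType} {U : finType} (F : sgraph U) (t : nat)
    (tau B rho z : R) (P : pred {ffun edge_sub F -> 'I_t}) :
  two_balanced F -> (3 <= v F)%N -> (2 <= e F)%N ->
  0 < tau <= 1 -> 1 <= B -> 0 <= rho <= B * tau ^+ (e F - 1) ->
  (0 < t)%N -> 0 <= z ->
  (forall f, P f -> (t%:R * tau ^+ (2 * (e F - 1) - (v F - 2))) ^+ #|f @: setT| <= z) ->
  \sum_(f | P f) \prod_j rho ^+ #|cover (fiber_edges f j)| <=
  B ^+ (2 * e F) * tau ^+ ((v F - 2) * e F) * (z * (e F ^ e F)%:R).
Proof.
move=> hF v3 e2 tau01 B1 rhoB t0 z0 Pz; have /andP[tau0 tau1] := tau01.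
have B0 : 0 <= B by apply: le_trans B1.
have t0' : 0 < (t%:R : R) by rewrite ltr0n.
set c := B ^+ _ * _; have c0 : 0 <= c by rewrite mulr_ge0 ?exprn_ge0 // ltW.
apply: le_trans (_ : \sum_(f | P f) c * (z * t%:R ^- #|f @: setT|) <= _).
  apply: ler_sum => f Pf; apply: le_trans (prod_fiber_le F _ _ _ f hF v3 e2 tau01 B1 rhoB) _.
  rewrite ler_wpM2l // ler_pdivlMr ?exprn_gt0 // mulrC -exprMn.
  exact: Pz.
rewrite -2!mulr_sumr ler_wpM2l // ler_wpM2l //.
rewrite -(card_edge_sub F); apply: le_trans (sum_image_weight _ t0).
rewrite [leRHS](bigID P) /= lerDl; apply: sumr_ge0 => f _.
by rewrite invr_ge0 exprn_ge0 // ltW.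
Qed.

(** * Dense case: cliques of about [tau ^ (e F - 1) * n] vertices *)

Lemma card_block_set {I J V : finType} (h : {ffun I -> {ffun J -> V}}) :
  (#|block_set h| <= #|I| * #|J|)%N.
Proof.
rewrite -card_prod -cardsT; apply: leq_trans (leq_imset_card (fun p => h p.1 p.2) _).
apply: subset_leq_card; apply/subsetP => x; rewrite inE => /existsP[i /existsP[j /eqP <-]].
by apply/imsetP; exists (i, j).
Qed.

Lemma exists_nat_between {R : archiRealFieldType} (x : R) : 1 <= x ->
  exists k : nat, (0 < k)%N /\ x <= k%:R <= 2 * x.
Proof.
move=> x1; have x0 : 0 <= x by apply: le_trans x1.
exists (Num.truncn x).+1; split=> //.
rewrite ltW ?truncnS_gt //= -[_.+1%:R]natr1.
have : (Num.truncn x)%:R <= x by rewrite truncn_le.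
lra.
Qed.

(* Average [X - a / (2 b) * Y]. *)
Lemma exists_tradeoff {R : realFieldType} {W : finType} (X Y : W -> R) (a b M : R) :
  (0 < #|W|)%N -> 0 < a -> 0 < b -> (forall w, 0 <= Y w) -> (forall w, X w <= M) ->
  #|W|%:R * a <= \sum_w X w -> \sum_w Y w <= #|W|%:R * b ->
  exists w, a / 2 <= X w /\ Y w <= 2 * M * b / a.
Proof.
move=> W0 a0 b0 Y0 XM sumX sumY; pose lam := a / (2 * b).
have lam0 : 0 < lam by rewrite divr_gt0 // mulr_gt0.
have [w Hw] : exists w : W, a / 2 <= X w - lam * Y w.
  apply: exists_ge_average W0 _.
  rewrite big_split /= sumrN -mulr_sumr.
  have : lam * (\sum_w Y w) <= lam * (#|W|%:R * b) by rewrite ler_pM2l.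
  have -> : lam * (#|W|%:R * b) = #|W|%:R * a / 2.
    by rewrite /lam; field; rewrite lt0r_neq0.
  lra.
have lY : 0 <= lam * Y w by rewrite mulr_ge0 // ltW.
exists w; split; first lra.
have -> : 2 * M * b / a = lam^-1 * M.
  by rewrite /lam; field; rewrite !lt0r_neq0.
by rewrite ler_pdivlMl //; have := XM w; lra.
Qed.

Lemma dense_case {R : realType} {U : finType} (F : sgraph U) (r : nat) :
  two_balanced F -> (2 <= e F)%N -> (2 <= r < v F)%N ->
  exists c C : R, 0 < c /\ 0 < C /\
    forall (n : nat) (tau : R), (r <= n)%N -> 0 < tau <= 1 ->
      1 <= tau ^+ (e F - 1) * n%:R ->
      exists G : sgraph 'I_n,
        c * (tau ^+ ((e F - 1) * (r - 2) + (v F - 2)) * n%:R ^+ r) <=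
          (num_copies (K r) G)%:R /\
        (num_copies F G)%:R <= C * (tau ^+ ((v F - 2) * e F) * n%:R ^+ v F).
Proof.
move=> hF e2 /andP[r2 rv]; have v3 : (3 <= v F)%N by apply: leq_ltn_trans rv.
have r0 : (0 < r)%N by apply: leq_trans r2.
have rR : 1 <= (r%:R : R) by rewrite ler1n.
have B1 : 1 <= 2 * r%:R :> R by lra.
have [c1 [c10 c1E]] : exists c1 : R, 0 < c1 /\ (3 * r%:R) ^- r / 2 = c1.
  by eexists; split; last reflexivity; rewrite divr_gt0 // invr_gt0 exprn_gt0 //; lra.
have rr0 : 0 < ((r ^ r)%:R : R) by rewrite ltr0n expn_gt0 r0.
have [C1 [C10 C1E]] : exists C1 : R,
    0 < C1 /\ C1 = (2 * r%:R) ^+ (2 * e F) * (2 ^+ e F * (e F ^ e F)%:R).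
  eexists; split; last reflexivity.
  apply: mulr_gt0; first by rewrite exprn_gt0 //; lra.
  by apply: mulr_gt0; rewrite ?exprn_gt0 // ltr0n expn_gt0 (ltnW e2).
(* The second constant comes from [2 * M * b / a] in [exists_tradeoff], with [M = 2 ^ r.+1 * a / c1]
   as in [X2]. *)
exists (c1 / 2 / (r ^ r)%:R), (2 * 2 ^+ r.+1 * C1 / c1).
split; first by apply: divr_gt0 => //; apply: divr_gt0.
split.
  by apply: divr_gt0 => //; apply: mulr_gt0 => //; apply: mulr_gt0 => //; apply: exprn_gt0.
move=> n tau rn tau01 ybig; have /andP[tau0 tau1] := tau01.
set A := (e F - 1)%N in ybig *; set D := (v F - 2)%N.
set x := tau ^+ (A * (r - 2) + D).
pose K0 := (2 * A - D)%N.
have D2A : (D <= 2 * A)%N by apply: two_balanced_v_le.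
have n0 : (0 < n)%N by apply: leq_trans rn.
have nR : 0 < (n%:R : R) by rewrite ltr0n.
(* [s] is the row length and [t], below, the number of blocks; each is within a factor 2 of its real
   target. *)
have [s [s0 /andP[s1 s2]]] := exists_nat_between _ ybig.
have tK0 : 0 < tau ^+ K0 by apply: exprn_gt0.
have tK : 1 <= tau ^- K0 by rewrite invf_ge1 // exprn_ile1 // ltW.
have [t [t0 /andP[t1 t2]]] := exists_nat_between _ tK.
have tA0 : 0 <= tau ^+ A by rewrite exprn_ge0 // ltW.
have tA1 : tau ^+ A <= 1 by rewrite exprn_ile1 // ltW.
have x0 : 0 < x by apply: exprn_gt0.
have x1 : x <= 1 by rewrite exprn_ile1 // ltW.
(* Since [A (r - 2) + D + K0 = A r], the quantity [x * n ^ r], which stands for [N], is [t * s ^ r]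
   up to a constant. *)
have xE : x = tau ^- K0 * tau ^+ A ^+ r.
  apply: (canRL (mulKf _)); first by rewrite lt0r_neq0.
  rewrite -exprM /x -exprD; congr (_ ^+ _).
  by rewrite addnCA subnK // [(2 * A)%N]mulnC -mulnDr subnK.
pose W : finType := {ffun 'I_t -> {ffun 'I_r -> {ffun 'I_s -> 'I_n}}}.
have W0 : (0 < #|W|)%N by rewrite !card_ffun !card_ord !expn_gt0 n0.
pose X (w : W) : R := #|transversals w setT|%:R.
pose Y (w : W) : R :=
  #|[set p | covered (F := F) (fun j => block_set (w j)) setT p & predT p.2]|%:R.
have [a [a0 aE]] : exists a, 0 < a /\ a = x * n%:R ^+ r * c1.
  eexists; split; last reflexivity.
  by apply: mulr_gt0 => //; apply: mulr_gt0 => //; apply: exprn_gt0.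
have [b [b0 bE]] : exists b, 0 < b /\ b = C1 * (tau ^+ (D * e F) * n%:R ^+ v F).
  eexists; split; last reflexivity.
  by apply: mulr_gt0 => //; apply: mulr_gt0; apply: exprn_gt0.
have sumX : #|W|%:R * a <= \sum_w X w.
  have := @sum_transversals_ge R 'I_t 'I_r 'I_s 'I_n x.
  rewrite [#|'I_t|]card_ord [#|'I_r|]card_ord [#|'I_s|]card_ord [#|'I_n|]card_ord c1E -aE.
  apply; rewrite ?r0 //.
  - rewrite -(ler_nat R) natrM; apply: le_trans s2 _.
    by apply: ler_wpM2l => //; rewrite ler_piMl // ltW.
  - by rewrite ltW.
  rewrite xE; apply: ler_pM => //; [by rewrite invr_ge0 ltW | exact: exprn_ge0 |].
  by rewrite lerXn2r ?nnegrE ?divr_ge0 // ler_pdivlMr.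
have sumY : \sum_w Y w <= #|W|%:R * b.
  apply: le_trans (sum_covered F predT _) _; first by rewrite card_ord.
  rewrite [#|'I_r|]card_ord [#|'I_s|]card_ord [#|'I_n|]card_ord -mulrA ler_wpM2l //.
  (* A block has at most [r * s <= 2 r * tau ^ A * n] vertices, whence [B = 2 r]. *)
  have rho : 0 <= ((r * s)%:R / n%:R : R) <= 2 * r%:R * tau ^+ (e F - 1).
    apply/andP; split; first exact: divr_ge0.
    rewrite (ler_pdivrMr _ _ nR).
    rewrite (natrM R r s).
    have -> : 2 * r%:R * tau ^+ (e F - 1) * n%:R = r%:R * (2 * (tau ^+ A * n%:R)).
      by rewrite -/A; move: (tau ^+ A) => q; ring.
    by rewrite ler_wpM2l.
  have two1 : 1 <= 2 :> R by rewrite ler1n.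
  have pow2 m : (t%:R * tau ^+ K0) ^+ m <= 2 ^+ m.
    have tt : 0 <= t%:R * tau ^+ K0 by apply: mulr_ge0 => //; exact: ltW.
    by rewrite lerXn2r ?nnegrE // -ler_pdivlMr.
  have z2 (f : {ffun edge_sub F -> 'I_t}) : predT f ->
      (t%:R * tau ^+ (2 * (e F - 1) - (v F - 2))) ^+ #|f @: setT| <= 2 ^+ e F.
    have fe : (#|f @: setT| <= e F)%N.
      by rewrite -(card_edge_sub F) -cardsT leq_imset_card.
    move=> _; apply: le_trans (_ : 2 ^+ #|f @: setT| <= _); first exact: pow2.
    exact: ler_weXn2l.
  have z0 : 0 <= 2 ^+ e F :> R by apply: exprn_ge0.
  have H := sum_prod_fiber_le F t tau _ _ _ predT hF v3 e2 tau01 B1 rho t0 z0 z2.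
  apply: le_trans (ler_wpM2l _ H) _ => //.
  rewrite le_eqVlt; apply/orP; left; apply/eqP.
  by rewrite bE C1E (natrX R n (v F)) [LHS]mulrC [X in X * _]mulrAC -!mulrA.
(* Every outcome, not only the average one, has [X] at most a constant times [a]; this is the bound
   [M] that [exists_tradeoff] requires. *)
have X2 w : X w <= 2 ^+ r.+1 * a / c1.
  have : (#|transversals w setT|%:R : R) <= t%:R * s%:R ^+ r.
    have := card_transversals_le w setT.
    by rewrite cardsT !card_ord -(ler_nat R) natrM natrX.
  move/le_trans; apply.
  apply: le_trans (_ : 2 * tau ^- K0 * (2 * (tau ^+ A * n%:R)) ^+ r <= _).
    have sr : s%:R ^+ r <= (2 * (tau ^+ A * n%:R)) ^+ r.
      by apply: lerXn2r => //; rewrite nnegrE //; apply: le_trans s2.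
    by apply: ler_pM => //; apply: exprn_ge0.
  rewrite le_eqVlt; apply/orP; left; apply/eqP.
  rewrite aE xE 2!exprMn [2 ^+ r.+1]exprS.
  move: (tau ^- K0) ((tau ^+ A) ^+ r) (n%:R ^+ r) (2 ^+ r) => k q m z; field.
  exact: lt0r_neq0.
have [w [Xw Yw]] := exists_tradeoff X Y _ _ _ W0 a0 b0 (fun w => ler0n _ _) X2 sumX sumY.
exists (union_cliques (fun j => block_set (w j)) setT); split.
  rewrite mulrAC ler_pdivrMr //.
  apply: le_trans (_ : X w <= _); first by apply: le_trans Xw; rewrite aE [leLHS]mulrC [leLHS]mulrA.
  by rewrite -natrM ler_nat mulnC card_transversals_le_copies.
apply: le_trans (_ : Y w <= _).
  rewrite ler_nat; apply: leq_trans (num_copies_union_cliques F _ _) _.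
  by apply: subset_leq_card; apply/subsetP => p; rewrite !inE andbT.
apply: le_trans Yw _.
rewrite le_eqVlt; apply/orP; left; apply/eqP.
rewrite bE; move: (_ * n%:R ^+ v F) (2 ^+ r.+1) => q z; field.
by rewrite !lt0r_neq0.
Qed.

(** * Sparse case: cliques of at most [r] vertices, and deletion *)

(* A single block is too small to contain [F], so it suffices to delete the block used by one
   fixed edge [k0] for every copy of [F] that uses at least two blocks. *)
Lemma num_copies_delete {I J U V : finType} (F : sgraph U) (t : nat)
    (w : {ffun 'I_t -> {ffun I -> {ffun J -> V}}}) :
  two_balanced F -> (2 <= e F)%N -> (3 <= v F)%N -> (#|I| * #|J| < v F)%N ->
  exists S : {set 'I_t},
    num_copies F (union_cliques (fun j => block_set (w j)) S) = 0%N /\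
    (#|~: S| <= #|[set p | covered (F := F) (fun j => block_set (w j)) setT p &
                    (1 < #|p.2 @: setT|)%N]|)%N.
Proof.
move=> hF e2 v3 small; set bad := [set p | _ & _].
have [k0 _] : exists k : edge_sub F, k \in setT.
  by apply/set0Pn; rewrite -card_gt0 cardsT card_edge_sub; apply: leq_trans e2.
pose S := ~: [set p.2 k0 | p : {ffun U -> V} * {ffun edge_sub F -> 'I_t} in bad].
exists S; split; last by rewrite setCK leq_imset_card.
apply/eqP; rewrite -leqn0; apply: leq_trans (num_copies_union_cliques F _ S) _.
rewrite leqn0 cards_eq0; apply/eqP/setP => -[phi f]; rewrite !inE.
apply/negP => /andP[/= phiI /forallP cov].
have covT : covered (F := F) (fun j => block_set (w j)) setT (phi, f).
  by apply/andP; split=> //; apply/forallP => k; rewrite inE; have /andP[] := cov k.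
have [f1|f1] := leqP #|f @: setT| 1; last first.
  have /andP[/= + _] := cov k0; rewrite inE => /negP; apply.
  by apply/imsetP; exists (phi, f) => //; rewrite inE covT.
have fk k : f k = f k0 by apply: (card_le1_eqP f1); apply: imset_f.
move: small; apply/negP; rewrite -leqNgt.
apply: leq_trans (card_block_set (w (f k0))).
rewrite /v -cardsT -(card_imset _ (injectiveP _ phiI)); apply: subset_leq_card.
rewrite -(cover_edges F hF v3 e2); apply/subsetP => _ /imsetP[u /bigcupP[x xF ux] ->].
have /andP[_ /subsetP] := cov (Sub x xF); rewrite /= fk; apply.
exact: imset_f.
Qed.

(** Here [x] may be less than 1, and then [k = 1] can exceed [2 * x]. In [sparse_case] the upper
    bound is needed only when there are at least two blocks. *)
Lemma exists_nat_below {R : archiRealFieldType} (x : R) : 0 <= x ->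
  exists k : nat, [/\ (0 < k)%N, x <= k%:R & (1 < k)%N -> k%:R <= 2 * x].
Proof.
move=> x0; exists (Num.truncn x).+1; split=> //; first by rewrite ltW ?truncnS_gt.
rewrite ltnS => k1; have kx : (Num.truncn x)%:R <= x by rewrite truncn_le.
have : 1 <= (Num.truncn x)%:R :> R by rewrite ler1n.
rewrite -[_.+1%:R]natr1; lra.
Qed.

Lemma sparse_case {R : realType} {U : finType} (F : sgraph U) (r : nat) :
  two_balanced F -> (2 <= e F)%N -> (2 <= r < v F)%N ->
  exists c : R, 0 < c /\
    forall (n : nat) (tau N : R), (r <= n)%N -> 0 < tau <= 1 ->
      tau ^+ (e F - 1) * n%:R = 1 ->
      1 <= N -> N <= tau ^- (2 * (e F - 1) - (v F - 2)) -> N <= n%:R ^+ r ->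
      exists G : sgraph 'I_n, c * N <= (num_copies (K r) G)%:R /\ num_copies F G = 0%N.
Proof.
move=> hF e2 /andP[r2 rv]; have v3 : (3 <= v F)%N by apply: leq_ltn_trans rv.
have r0 : (0 < r)%N by apply: leq_trans r2.
have rR : 1 <= (r%:R : R) by rewrite ler1n.
have r3 : 1 <= 3 * r%:R :> R by lra.
have deltaP (a b : R) : 0 < a -> a <= 1 -> 1 <= b ->
    exists d, [/\ 0 < d, 2 * d <= 1 & 4 * b * d = a].
  move=> a0 a1 b1; have b0 : 0 < b by lra.
  exists (a / (4 * b)); split.
  - by apply: divr_gt0 => //; lra.
  - by rewrite mulrA ler_pdivrMr; lra.
  - by field; rewrite lt0r_neq0.
have [c1 [c10 c11 c1E]] : exists c1 : R, [/\ 0 < c1, c1 <= 1 & (3 * r%:R) ^- r / 2 = c1].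
  have pos : 0 < (3 * r%:R) ^- r :> R by rewrite invr_gt0 exprn_gt0 //; lra.
  have le1 : (3 * r%:R) ^- r <= 1 :> R.
    by rewrite invf_le1 ?exprn_ege1 // exprn_gt0 //; lra.
  by eexists; split; last reflexivity; lra.
have rr0 : 0 < ((r ^ r)%:R : R) by rewrite ltr0n expn_gt0 r0.
have [C1 [C11 C1E]] : exists C1 : R,
    1 <= C1 /\ C1 = r%:R ^+ (2 * e F) * (e F ^ e F)%:R.
  eexists; split; last reflexivity.
  apply: mulr_ege1; first exact: exprn_ege1.
  by rewrite ler1n expn_gt0 (ltnW e2).
(* With [4 * C1 * delta = c1], the expected number of bad pairs is at most [t * c1 / 2], half the
   lower bound for the expected number of transversals. *)
have [delta [d0 d1 dE]] := deltaP _ _ c10 c11 C11.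
exists (c1 / 2 * delta / (r ^ r)%:R); split.
  by apply: divr_gt0 => //; apply: mulr_gt0 => //; apply: divr_gt0.
move=> n tau N rn tau01 taun N1 NK Nn; have /andP[tau0 tau1] := tau01.
have n0 : (0 < n)%N by apply: leq_trans rn.
have nR : 0 < (n%:R : R) by rewrite ltr0n.
have nr0 : 0 < n%:R ^+ r :> R by apply: exprn_gt0.
have N0 : 0 <= N by apply: le_trans N1.
have dN : 0 <= delta * N by apply: mulr_ge0 => //; exact: ltW.
have [t [t0 t1 t2]] : exists t : nat,
    [/\ (0 < t)%N, delta * N <= t%:R & (1 < t)%N -> t%:R <= 2 * (delta * N)].
  exact: exists_nat_below.
have tN : t%:R <= N.
  case: (leqP t 1) => [t_le1|/t2/le_trans]; last first.
    by apply; rewrite mulrA; apply: ler_piMl.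
  by apply: le_trans N1; rewrite (_ : 1 = 1%:R) // ler_nat.
have tR : 0 < (t%:R : R) by rewrite ltr0n.
have D2A := two_balanced_v_le F hF v3 e2.
have [k0 [k0E k00]] : exists k, tau ^+ (2 * (e F - 1) - (v F - 2)) = k /\ 0 < k.
  by eexists; split; first reflexivity; apply: exprn_gt0.
(* As [n = tau ^- A], this amounts to [D (e F) + (2 A - D) = A (v F)]. *)
have nv : n%:R ^+ v F * tau ^+ ((v F - 2) * e F) * k0 = 1.
  rewrite -k0E -mulrA -exprD.
  have -> : ((v F - 2) * e F + (2 * (e F - 1) - (v F - 2)) = (e F - 1) * v F)%N.
    move: D2A e2 v3; move: (e F) (v F) => a b; clear; move=> h a2 b3.
    rewrite -[X in (_ * X + _)%N](subnK (ltnW a2)) mulnDr muln1 -addnA subnKC //.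
    by rewrite [(2 * _)%N]mulnC mulnC -mulnDr subnK // ltnW.
  by rewrite exprM -exprMn mulrC taun expr1n.
have Nk : N * k0 <= 1 by rewrite -ler_pdivlMr // div1r -k0E.
have tk1 : t%:R * k0 <= 1 by apply: le_trans Nk; rewrite ler_wpM2r // ltW.
(* If [f] uses at least two blocks, then [(t k0) ^ #|f @: setT| <= (t k0) ^ 2] because [t k0 <= 1].
   One of the two factors [t] is then replaced by [2 delta N], which brings in the small constant
   [delta]. *)
have [z [z0 zE]] : exists z, 0 <= z /\ z = (2 * (delta * N) * k0) * (t%:R * k0).
  eexists; split; last reflexivity.
  have k00' := ltW k00.
  by apply: mulr_ge0; apply: mulr_ge0 => //; apply: mulr_ge0.
pose W : finType := {ffun 'I_t -> {ffun 'I_r -> {ffun 'I_1 -> 'I_n}}}.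
have W0 : (0 < #|W|)%N by rewrite !card_ffun !card_ord !expn_gt0 n0.
pose P (f : {ffun edge_sub F -> 'I_t}) := (1 < #|f @: setT|)%N.
pose X (w : W) : R := #|transversals w setT|%:R.
pose Y (w : W) : R :=
  #|[set p | covered (F := F) (fun j => block_set (w j)) setT p & P p.2]|%:R.
have sumX : #|W|%:R * (t%:R * c1) <= \sum_w X w.
  have := @sum_transversals_ge R 'I_t 'I_r 'I_1 'I_n (t%:R / n%:R ^+ r).
  rewrite [#|'I_t|]card_ord [#|'I_r|]card_ord [#|'I_1|]card_ord [#|'I_n|]card_ord c1E.
  rewrite divfK ?lt0r_neq0 //; apply; rewrite ?r0 //.
  - exact: leq_trans (leq_pmull _ _).
  - apply/andP; split; first by apply: divr_ge0; exact: ltW.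
    by rewrite ler_pdivrMr // mul1r; apply: le_trans Nn.
  by rewrite expr_div_n expr1n div1r.
have sumY : \sum_w Y w <= #|W|%:R * (t%:R * (c1 / 2)).
  apply: le_trans (sum_covered F P _) _; first by rewrite card_ord.
  rewrite [#|'I_r|]card_ord [#|'I_1|]card_ord [#|'I_n|]card_ord -mulrA ler_wpM2l // muln1.
  have rho : 0 <= (r%:R / n%:R : R) <= r%:R * tau ^+ (e F - 1).
    apply/andP; split; first by apply: divr_ge0.
    by rewrite (ler_pdivrMr _ _ nR) -mulrA taun mulr1.
  have zP f : P f ->
      (t%:R * tau ^+ (2 * (e F - 1) - (v F - 2))) ^+ #|f @: setT| <= z.
    move=> Pf; rewrite k0E zE.
    have t_gt1 : (1 < t)%N.
      by apply: leq_trans Pf _; rewrite -[X in (_ <= X)%N](card_ord t) max_card.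
    have u0 : 0 <= t%:R * k0 by apply: mulr_ge0; apply: ltW.
    apply: le_trans (_ : (t%:R * k0) ^+ 2 <= _); first exact: ler_wiXn2l.
    rewrite expr2; apply: ler_wpM2r => //; apply: ler_wpM2r; first exact: ltW.
    exact: t2.
  have H := sum_prod_fiber_le F t tau _ _ _ P hF v3 e2 tau01 rR rho t0 z0 zP.
  apply: le_trans (ler_wpM2l _ H) _ => //.
  have -> : (n ^ v F)%:R * (r%:R ^+ (2 * e F) * tau ^+ ((v F - 2) * e F) * (z * (e F ^ e F)%:R))
      = (n%:R ^+ v F * tau ^+ ((v F - 2) * e F) * k0) * ((2 * (delta * N) * k0) * (t%:R * C1)).
    rewrite zE C1E (natrX R n (v F)).
    move: (n%:R ^+ _) (tau ^+ _) (r%:R ^+ _) (_ ^ _)%:R => q1 q2 q3 q4; ring.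
  rewrite nv mul1r -dE.
  have -> : 2 * (delta * N) * k0 * (t%:R * C1) = (N * k0) * (t%:R * (4 * C1 * delta / 2)).
    by field.
  apply: ler_piMl => //; apply: mulr_ge0; first exact: ltW.
  by rewrite dE; apply: divr_ge0 => //; exact: ltW.
(* The rows have length one, so each of the at most [Y w] deleted blocks costs at most one
   transversal; hence the average of [X - Y]. *)
have [w Hw] : exists w : W, t%:R * (c1 / 2) <= X w - Y w.
  apply: exists_ge_average W0 _; rewrite sumrB lerBrDr.
  apply: le_trans (lerD (lexx _) sumY) _; apply: le_trans sumX.
  by rewrite -mulrDr -mulrDr -splitr.
have [|S [F0 SC]] := num_copies_delete F t w hF e2 v3; first by rewrite !card_ord muln1.
exists (union_cliques (fun j => block_set (w j)) S); split=> //.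
rewrite mulrAC ler_pdivrMr //.
apply: le_trans (_ : #|transversals w S|%:R <= _); last first.
  by rewrite -natrM ler_nat mulnC card_transversals_le_copies.
apply: le_trans (_ : t%:R * (c1 / 2) <= _).
  have -> : c1 / 2 * delta * N = delta * N * (c1 / 2) by field.
  by apply: ler_wpM2r => //; apply: divr_ge0 => //; exact: ltW.
apply: le_trans Hw _; rewrite lerBlDr -natrD ler_nat.
apply: leq_trans (card_transversals_split w S) _.
by rewrite card_ord exp1n muln1 leq_add2l.
Qed.

(** * Choice of [tau] and conclusion *)

Lemma bin_le_exp (n r : nat) : ('C(n, r) <= n ^ r)%N.
Proof.
apply: leq_trans (leq_pmulr _ (fact_gt0 r)) _.
have expE : (n ^ r = \prod_(i < r) n)%N by rewrite prod_nat_const card_ord.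
rewrite bin_ffact ffact_prod expE.
by apply: leq_prod => i _; apply: leq_subr.
Qed.

(** Both cases work with natural powers of the root [y]; the last clause translates them back into
    real powers of [x]. *)
Lemma exists_root {R : realType} (x : R) (m : nat) : (0 < m)%N -> 0 < x <= 1 ->
  exists y : R, [/\ 0 < y <= 1, y ^+ m = x & forall k : nat, y ^+ k = x `^ (k%:R / m%:R)].
Proof.
move=> m0 /andP[x0 x1]; have mR : (m%:R : R) != 0 by rewrite pnatr_eq0 -lt0n.
have yk k : (x `^ m%:R^-1) ^+ k = x `^ (k%:R / m%:R).
  by rewrite -powR_mulrn ?powR_ge0 // -powRrM mulrC.
exists (x `^ m%:R^-1); split=> //; last by rewrite yk divff // powRr1 // ltW.
rewrite powR_gt0 //=.
have := @ge0_ler_powR R m%:R^-1 _ x 1; rewrite powR1 invr_ge0 ler0n !nnegrE; apply=> //.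
exact: ltW.
Qed.

Lemma varphiE {R : realType} {U : finType} (F : sgraph U) (r : nat) :
  (1 <= e F)%N -> (2 <= v F)%N -> (2 <= r)%N ->
  (e F)%:R * varphi R F r =
  ((v F - 2) * e F)%:R / ((e F - 1) * (r - 2) + (v F - 2))%:R.
Proof.
move=> e1 v2 r2; rewrite /varphi mulrA; congr (_ / _).
  by rewrite natrM natrB // mulrC.
by rewrite natrD natrM !natrB //; ring.
Qed.

Theorem theorem1p4 (R : realType) (U : finType) (F : sgraph U) (r : nat)
    (hF : two_balanced F) (heF : (2 <= e F)%N) (hr : (2 <= r < v F)%N) :
  exists c C : R, 0 < c /\ 0 < C /\
    forall (n : nat) (N : R), 1 <= N -> N <= 'C(n, r)%:R ->
      exists G : sgraph 'I_n,
        c * N <= (num_copies (K r) G)%:R /\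
        (num_copies F G)%:R <=
          C * ((N / n%:R ^+ r) `^ ((e F)%:R * varphi R F r) * n%:R ^+ v F).
Proof.
have [c1 [C [c10 [C0 dense]]]] := @dense_case R U F r hF heF hr.
have [c2 [c20 sparse]] := @sparse_case R U F r hF heF hr.
have /andP[r2 rv] := hr; have v3 : (3 <= v F)%N by apply: leq_ltn_trans rv.
exists (Num.min c1 c2), C; split; first by rewrite lt_min c10.
split=> // n N N1 NC.
have N0 : 0 < N by apply: lt_le_trans N1.
have rn : (r <= n)%N.
  by rewrite -bin_gt0 -(ltr0n R); apply: lt_le_trans NC.
have Nn : N <= n%:R ^+ r by apply: le_trans NC _; rewrite -natrX ler_nat bin_le_exp.
have nR : 0 < (n%:R : R) by rewrite ltr0n; apply: leq_trans rn; apply: leq_trans r2.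
have nr0 : 0 < n%:R ^+ r :> R by apply: exprn_gt0.
have x01 : 0 < N / n%:R ^+ r <= 1 by rewrite divr_gt0 //= ler_pdivrMr // mul1r.
have L0 : (0 < (e F - 1) * (r - 2) + (v F - 2))%N.
  by rewrite addn_gt0 subn_gt0 v3 orbT.
have [tau [tau01 tauL tauk]] := exists_root _ _ L0 x01.
have NE : N = tau ^+ ((e F - 1) * (r - 2) + (v F - 2)) * n%:R ^+ r.
  by rewrite tauL divfK // lt0r_neq0.
rewrite varphiE ?(ltnW heF) ?(ltnW v3) // -tauk.
have [big|small] := lerP 1 (tau ^+ (e F - 1) * n%:R).
  have [G [GK GF]] := dense n tau rn tau01 big; exists G; split=> //.
  apply: le_trans GK; rewrite -NE; apply: ler_wpM2r; first exact: ltW.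
  by rewrite ge_min lexx.
have e1 : (0 < e F - 1)%N by rewrite subn_gt0.
have n01 : 0 < (n%:R^-1 : R) <= 1.
  by rewrite invr_gt0 nR invf_le1 // ler1n -(ltr0n R).
(* [tau0 = n ^ (- 1 / A)] is the border between the two cases. The sparse construction is run with
   [tau0] instead of the smaller [tau]. *)
have [tau0 [tau001 tau0e _]] := exists_root _ _ e1 n01.
have /andP[t0 _] := tau01; have /andP[t00 _] := tau001.
have tau0n : tau0 ^+ (e F - 1) * n%:R = 1 by rewrite tau0e mulVf // lt0r_neq0.
have tt0 : tau <= tau0.
  rewrite leNgt; apply: contraTN small => lt_t; rewrite -leNgt -[leLHS]tau0n.
  by rewrite ler_pM2r // lerXn2r // ?nnegrE ltW.
(* With [L = A (r - 2) + D], one has [N = tau ^ L * n ^ r <= tau0 ^ L * n ^ r], and [n = tau0 ^- A]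
   turns the right side into [tau0 ^ (L - A r) = tau0 ^- K]. *)
have NK : N <= tau0 ^- (2 * (e F - 1) - (v F - 2)).
  rewrite -div1r ler_pdivlMr ?exprn_gt0 //.
  apply: le_trans (_ : (tau0 ^+ (e F - 1) * n%:R) ^+ r <= _); last by rewrite tau0n expr1n.
  rewrite NE mulrAC exprMn.
  apply: ler_wpM2r; first exact: ltW.
  have D2A := two_balanced_v_le F hF v3 heF.
  have -> : tau0 ^+ (e F - 1) ^+ r = tau0 ^+ ((e F - 1) * (r - 2) + (v F - 2)) *
      tau0 ^+ (2 * (e F - 1) - (v F - 2)).
    by rewrite -exprM -exprD -addnA subnKC // [(2 * _)%N]mulnC -mulnDr subnK.
  apply: ler_wpM2r; first by rewrite exprn_ge0 // ltW.
  by rewrite lerXn2r // nnegrE ltW.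
have [G [GK GF]] := sparse n tau0 N rn tau001 tau0n N1 NK Nn.
exists G; split.
  by apply: le_trans GK; apply: ler_wpM2r; [exact: ltW | rewrite ge_min lexx orbT].
rewrite GF; apply: mulr_ge0; first exact: ltW.
by apply: mulr_ge0; apply: exprn_ge0 => //; exact: ltW.
Qed.
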